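(* For every integer $n\geq 0$, \begin{align*} \overline{p}_{-13}(8n+1) &\equiv 0 \pmod{2}, & \overline{p}_{-13}(8n+2) &\equiv 0 \pmod{4}, & \overline{p}_{-13}(8n+3) &\equiv 0 \pmod{8}, \\ \overline{p}_{-13}(8n+4) &\equiv 0 \pmod{2}, & \overline{p}_{-13}(8n+5) &\equiv 0 \pmod{8}, & \overline{p}_{-13}(8n+6) &\equiv 0 \pmod{8}, \end{align*} and \[ \overline{p}_{-13}(8n+7) \equiv 0 \pmod{256}. \]
   Context: For $|q|<1$ let $(a;q)_\infty=\prod_{i\geq 0}(1-aq^i)$. For a positive integer $t$, the number $\overline{p}_{-t}(n)$ of $t$-colored overpartitions of $n$ is defined by the generating function \[ \sum_{n\geq 0}\overline{p}_{-t}(n)q^n=\frac{(q^2;q^2)_\infty^t}{(q;q)_\infty^{2t}}. \] *)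

(* Defs.v *)
From HB Require Import structures.
From mathcomp Require Import all_boot all_order all_algebra.
From mathcomp Require Import all_classical all_reals all_analysis.
Set Implicit Arguments.
Unset Strict Implicit.
Unset Printing Implicit Defensive.
Import Order.TTheory GRing.Theory Num.Theory.
Import numFieldNormedType.Exports.
Local Open Scope classical_set_scope.
Local Open Scope ring_scope.

(* The infinite q-Pochhammer symbol (a; q)_oo; the limit exists when |q| < 1. *)
Definition qpochhammer (R : realType) (a q : R) : R :=
  lim ((fun N : nat => \prod_(0 <= i < N) (1 - a * q ^+ i)) @ \oo).

(* [p n] is the number of t-colored overpartitions of n for all n. The
   denominator does not vanish for |q| < 1, and the identity on the real
   interval ]-1, 1[ already determines p; it is implied by the same identity
   on the complex unit disc. *)
Definition colored_overpartition_numbers (R : realType) (t : nat)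
    (p : nat -> nat) : Prop :=
  forall q : R, `|q| < 1 ->
    series (fun n : nat => (p n)%:R * q ^+ n) @ \oo -->
      qpochhammer (q ^+ 2) (q ^+ 2) ^+ t / qpochhammer q q ^+ (2 * t).

(* Main.v *)
(** Write phi = 1 + 2 S with S = sum_(j >= 1) (-1)^j q^(j^2). By Gauss's theta
    product, phi = (q; q)^2 / (q^2; q^2), so the generating function is
    phi^(-13), which modulo 256 equals sum_(k < 8) C(12 + k, k) (-2 S)^k.
    Split S = A + B into the terms with odd and with even j: the exponents of A
    are 1 mod 8, those of B are 0 or 4 mod 8. For the class 7 mod 8, no sum of
    three squares contributes; the coefficient of S^4 carries 64, and the
    exponents 7 mod 8 come only from 4 (A^3 B + A B^3); the coefficient of S^5
    carries 128, and S^5 = (A + B) (A^4 + B^4) mod 2 has no exponent 7 mod 8;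
    the coefficients of S^6 and S^7 are divisible by 256. The other classes only
    need S^2 = A^2 + B^2 mod 2.

    Gauss's product is obtained from Shanks's finite identity, whose remainder is
    O(x^(n+1)) as x tends to 0. As only such estimates are used, the analytic
    hypothesis yields an identity of integer polynomials modulo 'X^(n+1). *)
Require Import Defs.
From mathcomp Require Import all_boot all_order all_algebra.
From mathcomp Require Import all_classical all_reals all_analysis.
From mathcomp Require Import ring lra zify.

Set Implicit Arguments.
Unset Strict Implicit.
Unset Printing Implicit Defensive.
Import Order.TTheory GRing.Theory Num.Theory.
Import numFieldNormedType.Exports.
Local Open Scope classical_set_scope.
Local Open Scope ring_scope.

(** * Shanks's finite identity and its remainder *)

(** The n-th partial product of phi, in the form (x; x)_n / (-x; x)_n. *)
Definition overprod (F : fieldType) (x : F) (n : nat) : F :=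
  \prod_(0 <= i < n) ((1 - x ^+ i.+1) / (1 + x ^+ i.+1)).

(** The first n terms of S, over any ring, so that [x] can be a real number or the indeterminate
    ['X]. *)
Definition theta_tail (A : nzRingType) (x : A) (n : nat) : A :=
  \sum_(0 <= j < n) (-1) ^+ j.+1 * x ^+ (j.+1 ^ 2).

Lemma overprodS (F : fieldType) (x : F) n :
  overprod x n.+1 = overprod x n * ((1 - x ^+ n.+1) / (1 + x ^+ n.+1)).
Proof. by rewrite /overprod big_nat_recr. Qed.

Lemma overprod_gt0 (F : realFieldType) (x : F) n :
  0 < x < 1 -> 0 < overprod x n.
Proof.
move=> /andP[x0 x1]; apply: prodr_gt0 => i _.
by rewrite divr_gt0 ?subr_gt0 ?exprn_ilt1 ?ltW// addr_gt0 ?exprn_gt0.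
Qed.

Lemma overprod_le (F : realFieldType) (x : F) m n :
  0 < x < 1 -> (m <= n)%N -> overprod x n <= overprod x m.
Proof.
move=> x01 /subnKC <-; elim: (n - m)%N => [|k IH]; first by rewrite addn0.
rewrite addnS overprodS; apply: le_trans IH.
rewrite ler_piMr ?(ltW (overprod_gt0 _ x01))//; case/andP: x01 => x0 x1.
have y0 := exprn_gt0 (m + k).+1 x0.
by rewrite ler_pdivrMr; lra.
Qed.

(* Shanks' finite form of Gauss's theta product. *)
Lemma shanks_identity (F : realFieldType) (x : F) n : 0 < x < 1 ->
  1 + 2 * theta_tail x n =
  \sum_(0 <= s < n.+1) (-1) ^+ s * (overprod x n / overprod x s)
     * (2 / (1 + x ^+ s)) * x ^+ (s * n.+1).
Proof.
move=> x01; have P0 k : overprod x k != 0 by rewrite gt_eqF ?overprod_gt0.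
have P00 : overprod x 0 = 1 by rewrite /overprod big_geq.
have x1 k : 1 + x ^+ k != 0.
  by rewrite gt_eqF// addr_gt0// exprn_gt0//; case/andP: x01.
elim: n => [|n IH].
  rewrite /theta_tail big_geq// big_nat1 P00 mul0n expr0.
  by field.
rewrite big_nat_recr//= /theta_tail big_nat_recr//= -/(theta_tail x n).
rewrite mulrDr addrA IH.
(* From n to n + 1 the summand of index s changes by [c * (u s.+1 - u s)], which telescopes; the
   value 0 at s = 0 removes the lower end. *)
pose u s := if s is s'.+1 then
  (-1) ^+ s' * x ^+ (s'.+1 * n.+1) / overprod x s' else 0.
pose c := - 2 * overprod x n / (1 + x ^+ n.+1).
have step s : (-1) ^+ s * (overprod x n.+1 / overprod x s) *
    (2 / (1 + x ^+ s)) * x ^+ (s * n.+2) =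
  (-1) ^+ s * (overprod x n / overprod x s) * (2 / (1 + x ^+ s))
    * x ^+ (s * n.+1) + c * (u s.+1 - u s).
  rewrite /c overprodS; case: s => [|s] /=.
    by rewrite P00 ?mul0n ?mul1n ?expr0; field; rewrite x1.
  have xs1 : 1 - x ^+ s.+1 != 0.
    by case/andP: x01 => x0 ?; rewrite subr_eq0 eq_sym lt_eqF// exprn_ilt1// ltW.
  rewrite (mulnS s.+1 n.+1) (mulSn s.+1 n.+1) !exprD [in (-1) ^+ s.+1]exprS.
  by rewrite !overprodS; field; rewrite !x1 P0 xs1.
rewrite (eq_bigr _ (fun s _ => step s)) big_split /= -mulr_sumr telescope_sumr//.
rewrite /u subr0 -addrA; congr (_ + _).
rewrite /c (mulnS n.+1 n.+1) exprD -mulnn overprodS exprS.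
by case/andP: x01 => x0 ?; field; rewrite x1 P0 subr_eq0 eq_sym lt_eqF// exprn_ilt1// ltW.
Qed.

(** In Shanks's sum the term s = 0 is the product itself. Each of the n others is at most 2 x^(n+1),
    because the partial products decrease and s (n + 1) >= n + 1. *)
Lemma theta_overprod_bound (F : realFieldType) (x : F) n : 0 < x < 1 ->
  `|1 + 2 * theta_tail x n - overprod x n| <= (2 * n%:R) * x ^+ n.+1.
Proof.
move=> x01; have P0 k := overprod_gt0 k x01; have /andP[x0 x1] := x01.
rewrite shanks_identity// big_nat_recl//= mul0n !expr0.
have -> : 1 * (overprod x n / overprod x 0) * (2 / (1 + 1)) * 1 = overprod x n.
  by rewrite [overprod x 0]/overprod big_geq//; field.
rewrite addrAC subrr add0r; apply: le_trans (ler_norm_sum _ _ _) _.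
apply: (@le_trans _ _ (\sum_(0 <= i < n) 2 * x ^+ n.+1)); last first.
  by rewrite sumr_const_nat subn0 mulrAC mulr_natr.
rewrite !big_nat; apply: ler_sum => s /= sn.
have y0 := exprn_gt0 s.+1 x0.
have c0 : 0 < 2 / (1 + x ^+ s.+1) by rewrite divr_gt0// addr_gt0.
have r0 : 0 < overprod x n / overprod x s.+1 by rewrite divr_gt0.
rewrite 3!normrM normrX normrN1 expr1n mul1r (gtr0_norm r0) (gtr0_norm c0).
rewrite ger0_norm ?exprn_ge0 ?(ltW x0)//.
apply: ler_pM; [exact: ltW (mulr_gt0 r0 c0)|exact: exprn_ge0 (ltW x0)| |].
  rewrite -[leRHS]mul1r; apply: ler_pM; [exact: ltW|exact: ltW| |].
    by rewrite ler_pdivrMr// mul1r overprod_le.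
  by rewrite ler_pdivrMr ?addr_gt0//; lra.
by rewrite ler_wiXn2l ?ltW// leq_pmull.
Qed.

(** * q-products and the limit phi(x) for 0 < x <= 1/4 *)

(** The factors are written as in the partial products of [qpochhammer x x]. *)
Definition qprod (F : nzRingType) (x : F) (n : nat) : F :=
  \prod_(0 <= i < n) (1 - x * x ^+ i).

Lemma qprodS (F : nzRingType) (x : F) n :
  qprod x n.+1 = qprod x n * (1 - x ^+ n.+1).
Proof. by rewrite /qprod big_nat_recr//= exprS. Qed.

Lemma overprod_qprod (F : realFieldType) (x : F) n : 0 < x < 1 ->
  overprod x n = qprod x n ^+ 2 / qprod (x ^+ 2) n.
Proof.
move=> /andP[x0 x1]; rewrite /overprod /qprod -prodrXl -prodf_div.
apply: eq_bigr => i _; rewrite -!exprS -!exprM mulnC exprM.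
have y0 := exprn_gt0 i.+1 x0.
have y1 : x ^+ i.+1 < 1 by rewrite exprn_ilt1// ltW.
move: (x ^+ i.+1) y0 y1 => y y0 y1; field.
by apply/andP; split; nra.
Qed.

(* The range ]0, 1/4] keeps every q-product above 1/2, so that the quotients
   of limits below are genuine. *)
Lemma qprod_lower (F : realFieldType) (x : F) n : 0 < x <= 1 / 4 ->
  1 - 2 * x + 2 * x ^+ n.+1 <= qprod x n.
Proof.
move=> /andP[x0 x1]; elim: n => [|n IH].
  by rewrite /qprod big_geq// expr1; lra.
rewrite qprodS [x ^+ n.+2]exprS.
have y0 := exprn_gt0 n.+1 x0.
have yx : x ^+ n.+1 <= x by rewrite -[leRHS]expr1 ler_wiXn2l//; lra.
(* With y = x^(n+1), the two sides differ by y - 2 y^2, and y <= 1/4. *)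
apply: le_trans (ler_wpM2r _ IH); nra.
Qed.

Lemma qprod_ge (F : realFieldType) (x : F) n : 0 < x <= 1 / 4 ->
  1 / 2 <= qprod x n.
Proof.
move=> x01; apply: le_trans (qprod_lower n x01); case/andP: x01 => x0 x1.
by have := exprn_gt0 n.+1 x0; lra.
Qed.

Lemma cvg_qprod (R : realType) (x : R) : 0 < x <= 1 / 4 ->
  qprod x n @[n --> \oo] --> qpochhammer x x.
Proof.
move=> x01; apply: nonincreasing_is_cvgn; last first.
  by exists (1 / 2) => _ [n _ <-]; exact: qprod_ge.
apply/nonincreasing_seqP => n; have := qprod_ge n x01.
have /andP[x0 x1] := x01; have := exprn_gt0 n.+1 x0.
by rewrite qprodS => *; nra.
Qed.

Lemma qpochhammer_gt0 (R : realType) (x : R) : 0 < x <= 1 / 4 ->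
  0 < qpochhammer x x.
Proof.
move=> x01; apply: (@lt_le_trans _ _ (1 / 2)); first by lra.
apply: limr_ge; first by apply/cvg_ex; eexists; exact: cvg_qprod.
by near=> n; exact: qprod_ge.
Unshelve. all: by end_near. Qed.

(** The value phi(x); the generating function at x is phi(x)^(-t). *)
Definition overprod_lim (R : realType) (x : R) : R :=
  qpochhammer x x ^+ 2 / qpochhammer (x ^+ 2) (x ^+ 2).

Lemma cvg_overprod (R : realType) (x : R) : 0 < x <= 1 / 4 ->
  overprod x n @[n --> \oo] --> overprod_lim x.
Proof.
move=> x01; have x201 : 0 < x ^+ 2 <= 1 / 4.
  by case/andP: x01 => x0 x1; apply/andP; split; nra.
have x01' : 0 < x < 1 by case/andP: x01 => x0 x1; apply/andP; split; lra.
rewrite (_ : overprod x = fun n => qprod x n * qprod x n / qprod (x ^+ 2) n); last first.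
  by apply: funext => n; rewrite overprod_qprod.
rewrite /overprod_lim expr2.
apply: cvgM; first by apply: cvgM; exact: cvg_qprod.
by apply: cvgV (cvg_qprod x201); rewrite gt_eqF// qpochhammer_gt0.
Qed.

Lemma overprod_lim_gt0 (R : realType) (x : R) : 0 < x <= 1 / 4 ->
  0 < overprod_lim x.
Proof.
move=> x01; have x201 : 0 < x ^+ 2 <= 1 / 4.
  by case/andP: x01 => x0 x1; apply/andP; split; nra.
by rewrite divr_gt0 ?exprn_gt0 ?qpochhammer_gt0.
Qed.

Lemma overprod_lim_le1 (R : realType) (x : R) : 0 < x <= 1 / 4 ->
  overprod_lim x <= 1.
Proof.
move=> x01; apply: (cvgr_to_le (cvg_overprod x01)).
near=> n; have := @overprod_le _ x 0 n; rewrite {2}/overprod big_geq//.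
by apply => //; lra.
Unshelve. all: by end_near. Qed.

Lemma overprod_lim_tail (R : realType) (x : R) n : 0 < x <= 1 / 4 ->
  `|overprod x n - overprod_lim x| <= 4 * x ^+ n.+1.
Proof.
move=> x01; have x01' : 0 < x < 1.
  by case/andP: x01 => x0 x1; apply/andP; split; lra.
(* The last term on the left makes the induction close: with y = x^(n+k+1), a new factor lowers the
   product by at most 2 y, while 4 y drops to 4 x y <= y. *)
have key k : overprod x n - 4 * x ^+ n.+1 + 4 * x ^+ (n + k).+1
    <= overprod x (n + k).
  elim: k => [|k IH]; first by rewrite addn0; lra.
  rewrite addnS overprodS [x ^+ (n + k).+2]exprS.
  have P1 : overprod x (n + k) <= 1.
    by have := @overprod_le _ x 0 (n + k); rewrite {2}/overprod big_geq//; apply.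
  have P0 := overprod_gt0 (n + k) x01'.
  case/andP: x01 => x0 x1; have y0 := exprn_gt0 (n + k).+1 x0.
  move: (overprod x (n + k)) (x ^+ (n + k).+1) IH P0 P1 y0 => P y IH P0 P1 y0.
  have -> : P * ((1 - y) / (1 + y)) = P - P * (2 * y / (1 + y)).
    by field; rewrite gt_eqF//; lra.
  have yx := ler_wpM2r (ltW y0) x1.
  suff : P * (2 * y / (1 + y)) <= 1 * (2 * y) by lra.
  apply: ler_pM => //; [exact: ltW|by apply: divr_ge0; lra|].
  by rewrite ler_pdivrMr; nra.
have lo : overprod x n - 4 * x ^+ n.+1 <= overprod_lim x.
  apply: (cvgr_to_ge (cvg_overprod x01)); near=> m.
  have /subnKC <- : (n <= m)%N by near: m; exact: nbhs_infty_ge.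
  apply: le_trans (key _); rewrite lerDl mulr_ge0// exprn_ge0//; lra.
have hi : overprod_lim x <= overprod x n.
  apply: (cvgr_to_le (cvg_overprod x01)); near=> m.
  by apply: overprod_le => //; near: m; exact: nbhs_infty_ge.
by rewrite ger0_norm ?subr_ge0//; lra.
Unshelve. all: by end_near. Qed.

Lemma theta_overprod_lim (R : realType) (x : R) n : 0 < x <= 1 / 4 ->
  `|1 + 2 * theta_tail x n - overprod_lim x| <= (2 * n%:R + 4) * x ^+ n.+1.
Proof.
move=> x01; have x01' : 0 < x < 1.
  by case/andP: x01 => x0 x1; apply/andP; split; lra.
rewrite [leRHS]mulrDl; apply: le_trans (ler_distD (overprod x n) _ _) _.
by rewrite lerD ?overprod_lim_tail ?theta_overprod_bound.
Qed.

(** * The overpartition series near 0 *)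

Lemma overpartition_sum (R : realType) t p (x : R) : 0 < x <= 1 / 4 ->
  colored_overpartition_numbers R t p ->
  series (fun n => (p n)%:R * x ^+ n) @ \oo --> (overprod_lim x ^+ t)^-1.
Proof.
move=> x01 hp; have /(_ _)/cvg_trans := hp x; apply; first by rewrite ger0_norm; lra.
by rewrite /overprod_lim expr_div_n invf_div exprM.
Qed.

(** The terms are nonnegative, and x^i <= (4 x)^N (1/4)^i for i >= N, so the tail at x is at most (4
    x)^N times the full sum at 1/4. *)
Lemma overpartition_tail (R : realType) t p N :
  colored_overpartition_numbers R t p ->
  exists C, forall x : R, 0 < x <= 1 / 4 ->
  `|series (fun n => (p n)%:R * x ^+ n) N - (overprod_lim x ^+ t)^-1|
    <= C * x ^+ N.
Proof.
move=> hp; pose S (x : R) := (overprod_lim x ^+ t)^-1.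
exists (4 ^+ N * S (1 / 4)) => x x01; have /andP[x0 x1] := x01.
have hS y : 0 < y <= 1 / 4 -> series (fun n => (p n)%:R * y ^+ n) @ \oo --> S y.
  by move=> y01; exact: overpartition_sum.
have mono (y : R) : 0 < y -> nondecreasing_seq (series (fun n => (p n)%:R * y ^+ n)).
  move=> y0; apply/nondecreasing_seqP => n.
  by rewrite /series/= big_nat_recr//= lerDl mulr_ge0// exprn_ge0// ltW.
have ub (y : R) n : 0 < y <= 1 / 4 -> series (fun n => (p n)%:R * y ^+ n) n <= S y.
  move=> y01; have /cvg_lim <- // := hS y y01.
  apply: nondecreasing_cvgn_le; first by apply: mono; case/andP: y01.
  by apply/cvg_ex; eexists; exact: hS.
rewrite -/(S x) distrC ger0_norm ?subr_ge0 ?ub// lerBlDl.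
apply: (cvgr_to_le (hS x x01)); near=> m.
have Nm : (N <= m)%N by near: m; exact: nbhs_infty_ge.
rewrite -lerBlDl sub_series_geq//.
have q01 : 0 < 1 / 4 :> R by lra.
apply: (@le_trans _ _ (4 ^+ N * x ^+ N * \sum_(N <= i < m) (p i)%:R * (1 / 4) ^+ i)).
  rewrite mulr_sumr !big_nat; apply: ler_sum => i /andP[Ni _].
  rewrite mulrCA ler_wpM2l// -(subnKC Ni) !exprD.
  have e : 4 ^+ N * (1 / 4) ^+ N = 1 :> R.
    by rewrite -exprMn mulrC divfK// expr1n.
  rewrite mulrACA e !mul1r ler_wpM2l ?exprn_ge0 ?(ltW x0)//.
  by rewrite lerXn2r// ?nnegrE ?invr_ge0 ?(ltW x0)//; lra.
rewrite [leRHS]mulrAC ler_wpM2l//.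
  by rewrite mulr_ge0// exprn_ge0// ltW.
have q1 : 0 < (1 / 4 : R) <= 1 / 4 by apply/andP; split.
apply: le_trans (ub _ m q1); rewrite -sub_series_geq// gerBl.
by rewrite /series/= sumr_ge0// => i _; rewrite mulr_ge0// exprn_ge0// ltW.
Unshelve. all: by end_near. Qed.

(** * From estimates near 0 to vanishing coefficients *)

Lemma horner_bound (R : realFieldType) (Q : {poly R}) :
  exists2 M, 0 <= M & forall x : R, 0 < x <= 1 / 4 -> `|Q.[x]| <= M.
Proof.
exists (\sum_(i < size Q) `|Q`_i|) => [|x /andP[x0 x1]]; first exact: sumr_ge0.
rewrite horner_coef; apply: le_trans (ler_norm_sum _ _ _) _.
apply: ler_sum => i _; rewrite normrM ler_piMr// normrX.
by rewrite exprn_ile1// ger0_norm; lra.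
Qed.

(** The constant term is O(x), hence 0; dividing by x lowers both the polynomial and the order N by
    one. *)
Lemma poly_small_at0 (R : realFieldType) (Q : {poly R}) (C : R) N :
  (forall x : R, 0 < x <= 1 / 4 -> `|Q.[x]| <= C * x ^+ N) ->
  forall i, (i < N)%N -> Q`_i = 0.
Proof.
elim: N Q => [//|N IH] Q; elim/poly_ind: Q => [|Q c _] QC i; first by rewrite coef0.
have c0 : c = 0.
  have [M M0 QM] := horner_bound Q; apply/eqP/negP => /negP; rewrite -normr_gt0 => c0.
  have C0 : 0 <= C.
    have q01 : 0 < (1 / 4 : R) <= 1 / 4.
      apply/andP; split; lra.
    have := le_trans (normr_ge0 _) (QC _ q01).
    by rewrite pmulr_lge0// exprn_gt0//; lra.
  have cx x : 0 < x <= 1 / 4 -> `|c| <= (C + M) * x.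
    move=> x01; have /andP[x0 x1] := x01.
    have -> : c = (Q * 'X + c%:P).[x] - Q.[x] * x by rewrite !hornerE; ring.
    apply: le_trans (ler_normB _ _) _; rewrite mulrDl; apply: lerD.
      apply: le_trans (QC x x01) _; rewrite ler_wpM2l// -[leRHS]expr1.
      by rewrite ler_wiXn2l//; lra.
    by rewrite normrM (gtr0_norm x0) ler_wpM2r ?QM ?(ltW x0).
  (* The point x = |c| / d lies in ]0, 1/4] as d >= 4 |c|, and d > C + M contradicts [cx] there. *)
  pose d := 4 * (C + M + 1) + 4 * `|c|; have d0 : 0 < d by rewrite /d; lra.
  have : 0 < `|c| / d <= 1 / 4.
    by rewrite divr_gt0//= ler_pdivrMr// /d; lra.
  by move/cx; rewrite mulrA ler_pdivlMr// /d; nra.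
rewrite c0 addr0 coefMX; case: i => [//|i] /=; rewrite ltnS; apply: IH => x x01.
have /andP[x0 _] := x01; have := QC x x01.
by rewrite c0 addr0 hornerMX normrM exprSr mulrA (gtr0_norm x0) ler_pM2r.
Qed.

Lemma rmorph_theta_tail (A B : nzRingType) (f : {rmorphism A -> B}) x n :
  f (theta_tail x n) = theta_tail (f x) n.
Proof.
rewrite /theta_tail rmorph_sum; apply: eq_bigr => i _.
by rewrite rmorphM !rmorphXn rmorphN1.
Qed.

Lemma poly_shift_of_coef0 (A : nzRingType) (Q : {poly A}) N :
  (forall i, (i < N)%N -> Q`_i = 0) -> exists V, Q = V * 'X^N.
Proof.
move=> Q0; exists (drop_poly N Q).
rewrite -[LHS](poly_take_drop N) [take_poly _ _](_ : _ = 0) ?add0r//.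
by apply/polyP => i; rewrite coef_take_poly coef0; case: ltnP => // /Q0.
Qed.


(** * Truncated binomial series *)

(** The factor 1 - v turns the series of (1 - v)^(-t-2) into that of (1 - v)^(-t-1) by Pascal's
    rule; truncation leaves one top term. *)
Lemma geometric_power_step (A : comNzRingType) (v : A) t N :
  (1 - v) * (\sum_(k < N.+1) 'C(t.+1 + k, k)%:R * v ^+ k) =
  \sum_(k < N.+1) 'C(t + k, k)%:R * v ^+ k - 'C(t.+1 + N, N)%:R * v ^+ N.+1.
Proof.
elim: N => [|N IH].
  by rewrite !big_ord_recr !big_ord0 /= !addn0 !bin0; ring.
rewrite big_ord_recr mulrDr IH [in RHS]big_ord_recr /=.
by rewrite (addnS t.+1 N) -(addSnnS t N) binS natrD !exprS; ring.
Qed.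

(** Used at v = -2 S, t = 12, N = 7, where v^8 = 256 S^8 makes the error vanish modulo 256. *)
Lemma inverse_power_trunc (A : comNzRingType) (v : A) t N : exists z,
  (1 - v) ^+ t.+1 * (\sum_(k < N.+1) 'C(t + k, k)%:R * v ^+ k)
  = 1 + v ^+ N.+1 * z.
Proof.
elim: t => [|t [z IH]].
  exists (- 1); rewrite expr1 -(opprB v 1) mulNr.
  under eq_bigr do rewrite add0n binn mul1r.
  by rewrite -subrX1; ring.
exists (z - (1 - v) ^+ t.+1 * 'C(t.+1 + N, N)%:R).
rewrite exprSr -mulrA geometric_power_step mulrBr IH.
by move: ('C(_, _)%:R) ((1 - v) ^+ _) => a b; ring.
Qed.

(** * The generating identity for integer polynomials *)

(** At real x in ]0, 1/4] the left side is 1 + O(x^(N+1)), so its low coefficients agree with those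
    of 1 over the reals, hence over the integers. *)
Lemma overpartition_formal (R : realType) t p N :
  colored_overpartition_numbers R t p ->
  exists V : {poly int},
  (\poly_(i < N.+1) (p i)%:Z) * (1 + 2 * theta_tail 'X N) ^+ t
    = 1 + V * 'X^(N.+1).
Proof.
move=> hp; set P := \poly_(i < _) _; set T := 1 + _.
suff Q0 : forall i, (i < N.+1)%N -> (P * T ^+ t - 1)`_i = 0.
  have [V VE] := poly_shift_of_coef0 Q0.
  by exists V; rewrite -VE addrC subrK.
pose f : {rmorphism int -> R} := intr.
pose PR := map_poly f P; pose TR := map_poly f T.
have PRE x : PR.[x] = series (fun n => (p n)%:R * x ^+ n) N.+1.
  rewrite /PR /P poly_def rmorph_sum horner_sum /series/= big_mkord.
  by apply: eq_bigr => i _; rewrite map_polyZ map_polyXn hornerZ hornerXn /= -pmulrn.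
have TRE x : TR.[x] = 1 + 2 * theta_tail x N.
  rewrite /TR rmorphD rmorphM rmorph1 rmorph_nat rmorph_theta_tail /= map_polyX.
  rewrite -horner_evalE rmorphD rmorphM rmorph1 rmorph_nat rmorph_theta_tail.
  by rewrite /= horner_evalE hornerX.
have [C PC] := overpartition_tail N.+1 hp.
(* The truncated theta series replaces phi(x) one factor at a time; boundedness of the other factors
   keeps the error O(x^(N+1)). *)
have pow k : exists D, forall x, 0 < x <= 1 / 4 ->
    `|(PR * TR ^+ k).[x] - (overprod_lim x ^+ t)^-1 * overprod_lim x ^+ k|
       <= D * x ^+ N.+1.
  elim: k => [|k [D IH]].
    by exists C => x x01; rewrite !expr0 !mulr1 PRE PC.
  have [M M0 PM] := horner_bound (PR * TR ^+ k).
  exists (D + M * (2 * N%:R + 4)) => x x01; have /andP[x0 _] := x01.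
  have L0 := overprod_lim_gt0 x01; have L1 := overprod_lim_le1 x01.
  rewrite !(exprSr _ k) (mulrA PR) (mulrA _ _ (overprod_lim x)) hornerM.
  rewrite [leRHS]mulrDl [leRHS]addrC.
  apply: le_trans (ler_distD ((PR * TR ^+ k).[x] * overprod_lim x) _ _) _.
  rewrite -mulrBl -mulrBr (normrM _ (overprod_lim x)) normrM; apply: lerD; last first.
    rewrite (gtr0_norm L0); apply: le_trans (IH x x01).
    by rewrite ler_piMr.
  rewrite -mulrA; apply: ler_pM => //; first exact: PM.
  by rewrite TRE theta_overprod_lim.
have [D key] := pow t.
have {}key : forall x, 0 < x <= 1 / 4 ->
    `|(PR * TR ^+ t - 1).[x]| <= D * x ^+ N.+1.
  move=> x x01; rewrite hornerD hornerN hornerC.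
  apply: le_trans (key x x01); rewrite mulVf// expf_neq0// gt_eqF//.
  exact: overprod_lim_gt0.
move=> i iN; apply/eqP; rewrite -(intr_eq0 R); apply/eqP.
have := poly_small_at0 key iN.
by rewrite -rmorphXn -rmorphM -(rmorph1 (map_poly f)) -rmorphB coef_map.
Qed.

(** Both sides of the first equation are multiplied by [W]: up to multiples of [X] and [c], [P] is
    the approximate inverse [W] of [T]. *)
Lemma solve_inverse_mod (A : comNzRingType) (P T W X V z c : A) :
  P * T = 1 + V * X -> T * W = 1 + c * z ->
  P = W + X * (V * W) - c * (z * P).
Proof.
move=> PT TW; have : P * (T * W) = (P * T) * W by rewrite mulrA.
rewrite TW PT => /eqP; rewrite -subr_eq0 => /eqP e.
by apply/eqP; rewrite -subr_eq0 -e; apply/eqP; ring.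
Qed.

(** * Exponents modulo 8 *)

(** [true] gives A and [false] gives B in the splitting S = A + B; the index is [j.+1]. *)
Definition theta_part (A : nzRingType) (b : bool) (x : A) n : A :=
  \sum_(0 <= j < n | odd j.+1 == b) (-1) ^+ j.+1 * x ^+ (j.+1 ^ 2).

Lemma theta_tail_parts (A : nzRingType) (x : A) n :
  theta_tail x n = theta_part true x n + theta_part false x n.
Proof.
rewrite /theta_tail (bigID (fun j => odd j.+1 == true)) .
by congr (_ + _); apply: eq_bigl => j; case: (odd _).
Qed.

(** The list only bounds the residues of the exponents and may repeat entries, so lists for sums and
    products are computed and membership is decided by evaluation. *)
Definition supp8 (A : nzRingType) (s : seq nat) (Q : {poly A}) :=
  forall i, (i %% 8)%N \notin s -> Q`_i = 0.

Lemma supp8_sum (A : nzRingType) s n (a : pred nat) (F : nat -> {poly A}) :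
  (forall j, a j -> supp8 s (F j)) -> supp8 s (\sum_(0 <= j < n | a j) F j).
Proof. by move=> sF i si; rewrite coef_sum big1// => j /sF->. Qed.

Lemma supp8D (A : nzRingType) s t (P Q : {poly A}) :
  supp8 s P -> supp8 t Q -> supp8 (s ++ t) (P + Q).
Proof.
move=> sP tQ i; rewrite mem_cat negb_or => /andP[/sP Pi /tQ Qi].
by rewrite coefD Pi Qi addr0.
Qed.

Lemma supp8M (A : nzRingType) s t (P Q : {poly A}) :
  supp8 s P -> supp8 t Q ->
  supp8 [seq ((a + b) %% 8)%N | a <- s, b <- t] (P * Q).
Proof.
move=> sP tQ i si; rewrite coefM big1// => -[j /=]; rewrite ltnS => ji _.
have [js|/sP->] := boolP ((j %% 8)%N \in s); last by rewrite mul0r.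
have [jt|/tQ->] := boolP (((i - j) %% 8)%N \in t); last by rewrite mulr0.
case/negP: si; apply/allpairsP; exists ((j %% 8)%N, ((i - j) %% 8)%N).
by split=> //=; rewrite modnDm subnKC.
Qed.

Lemma supp8Z (A : nzRingType) s (P : {poly A}) m :
  supp8 s P -> supp8 s (m%:R * P).
Proof. by move=> sP i /sP Pi; rewrite mulr_natl coefMn Pi mul0rn. Qed.

Lemma supp8N (A : nzRingType) s (P : {poly A}) :
  supp8 s P -> supp8 s (- P).
Proof. by move=> sP i /sP Pi; rewrite coefN Pi oppr0. Qed.

Lemma supp8_1 (A : nzRingType) : supp8 [:: 0%N] (1 : {poly A}).
Proof. by case=> [//|i _]; rewrite coef1. Qed.

Lemma sqr_mod8 m : (m ^ 2 %% 8)%N \in (if odd m then [:: 1] else [:: 0; 4])%N.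
Proof.
rewrite -modnXm -(@odd_mod m 8)//.
by move: (m %% 8)%N (ltn_pmod m (isT : 0 < 8)%N); do 8?case=> //.
Qed.

Lemma supp8_theta_part (A : nzRingType) b n :
  supp8 (if b then [:: 1] else [:: 0; 4])%N (theta_part b ('X : {poly A}) n).
Proof.
apply: supp8_sum => j /eqP oj i ib; rewrite -signr_odd mulr_sign.
have ij : i != (j.+1 ^ 2)%N.
  by apply: contraNneq ib => ->; rewrite -oj; exact: sqr_mod8.
by case: (odd _); rewrite ?coefN coefXn (negbTE ij) ?oppr0.
Qed.

Arguments supp8Z {A s P} m.

(** * Reduction modulo 256 and the congruences *)

(** The factors 64, 128 and 256 combine the powers of 2 in the binomials with those of (-2)^k. *)
Lemma binomial_series13 (A : comNzRingType) (s : A) :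
  \sum_(k < 8) 'C(12 + k, k)%:R * (- (2 * s)) ^+ k =
  1 - 26 * s + 364 * s ^+ 2 - 3640 * s ^+ 3 + 64 * 455 * s ^+ 4
  - 128 * 1547 * s ^+ 5 + 256 * (4641 * s ^+ 6 - 6 * 4199 * s ^+ 7).
Proof.
rewrite !big_ord_recr big_ord0 /=.
have -> : 'C(12 + 0, 0) = 1%N by vm_compute.
have -> : 'C(12 + 1, 1) = 13%N by vm_compute.
have -> : 'C(12 + 2, 2) = 91%N by vm_compute.
have -> : 'C(12 + 3, 3) = 455%N by vm_compute.
have -> : 'C(12 + 4, 4) = (4 * 455)%N by vm_compute.
have -> : 'C(12 + 5, 5) = (4 * 1547)%N by vm_compute.
have e6 : 'C(18, 6) = (4 * 4641)%N by vm_compute.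
have -> : 'C(12 + 7, 7) = (12 * 4199)%N.
  have e7 : (19 * 'C(18, 6) = 7 * 'C(19, 7))%N := mul_bin_diag 19 6.
  by change (12 + 7)%N with 19%N; move: e7; rewrite e6; lia.
have -> : 'C(12 + 6, 6) = (4 * 4641)%N := e6.
by rewrite !natrM; ring.
Qed.

Lemma coef_natl (A : nzRingType) m (Q : {poly A}) i :
  (m%:R * Q)`_i = m%:R * Q`_i.
Proof. by rewrite !mulr_natl coefMn. Qed.

(** Truncating at [i] itself suffices: the error is a multiple of ['X^(i.+1)] plus a multiple of
    256. *)
Lemma overpartition13_mod256 (R : realType) p i :
  colored_overpartition_numbers R 13 p ->
  exists z : int, (p i)%:Z =
  (\sum_(k < 8) 'C(12 + k, k)%:R * (- (2 * theta_tail ('X : {poly int}) i)) ^+ k)`_i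
   + 256 * z.
Proof.
move=> hp; have [V PT] := overpartition_formal i hp.
set s := theta_tail _ _ in PT *.
have [z] := inverse_power_trunc (- (2 * s)) 12 7; set W := \sum_(k < 8) _.
rewrite opprK (_ : (- (2 * s)) ^+ 8 = 256 * s ^+ 8); last by ring.
rewrite -(mulrA 256) => TW; have := solve_inverse_mod PT TW.
move=> /(congr1 (fun Q : {poly int} => Q`_i)); rewrite coef_poly ltnSn => ->.
rewrite coefB coefD coef_natl coefXnM ltnSn addr0.
by eexists; rewrite -mulrN.
Qed.

Lemma eqmod0_of_coef (p m i : nat) (s : seq nat) (W G H : {poly int}) (z : int) :
  (m %| 256)%N -> p%:Z = W`_i + 256 * z -> W = G + m%:R * H ->
  supp8 s G -> (i %% 8)%N \notin s -> p = 0 %[mod m].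
Proof.
move=> m256 pE WE sG /sG Gi; apply/eqP; rewrite mod0n -/(dvdn m p).
rewrite (_ : (m %| p)%N = (m%:Z %| p%:Z)%Z)// pE WE coefD Gi add0r coef_natl !natz.
by rewrite rpredD// dvdz_mulr//.
Qed.

Lemma overpartition13_congruences (R : realType) p i :
  colored_overpartition_numbers R 13 p ->
  [/\ (i %% 8)%N != 0%N -> p i = 0%N %[mod 2],
      (i %% 8)%N \notin [:: 0; 1; 4]%N -> p i = 0%N %[mod 4],
      (i %% 8)%N \notin [:: 0; 1; 2; 4]%N -> p i = 0%N %[mod 8] &
      (i %% 8)%N = 7%N -> p i = 0%N %[mod 256]].
Proof.
move=> hp.
pose A := theta_part true ('X : {poly int}) i.
pose B := theta_part false ('X : {poly int}) i.
(* The terms of degree at least 3 in S = A + B, divided by 8. *)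
pose R3 := - 455 * (A + B) ^+ 3 + 8 * 455 * (A + B) ^+ 4
  - 16 * 1547 * (A + B) ^+ 5
  + 32 * (4641 * (A + B) ^+ 6 - 6 * 4199 * (A + B) ^+ 7).
have sA : supp8 [:: 1]%N A := @supp8_theta_part _ true i.
have sB : supp8 [:: 0; 4]%N B := @supp8_theta_part _ false i.
have sS := supp8D sA sB.
have sA2 := supp8M sA sA.
have sB2 := supp8M sB sB.
have [z] := overpartition13_mod256 i hp.
rewrite binomial_series13 theta_tail_parts -/A -/B => piE.
have s1 : supp8 [:: 0]%N (1 : {poly int}) := @supp8_1 _.
have s4 := supp8D s1 (supp8N (supp8Z 26 sS)).
split=> i8.
- apply: (eqmod0_of_coef (m := 2) (s := [:: 0%N])
     (H := - 13 * (A + B) + 182 * (A + B) ^+ 2 + 4 * R3) _ piE _ s1) => //.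
    by rewrite /R3; ring.
  by rewrite inE.
- apply: (eqmod0_of_coef (m := 4)
     (H := 91 * (A + B) ^+ 2 + 2 * R3) _ piE _ s4) => //.
    by rewrite /R3; ring.
  by move: i8; rewrite !inE; do !case: eqP.
(* The cross term of 364 S^2 is 728 A B = 8 * 91 A B; the rest lives in the classes 0, 1, 2, 4. *)
- apply: (eqmod0_of_coef (m := 8) (H := 91 * A * B + R3) _ piE _
     (supp8D s4 (supp8Z 364 (supp8D sA2 sB2)))) => //.
    by rewrite /R3; ring.
  by move: i8; rewrite !inE; do !case: eqP.
- have sS2 := supp8M sS sS.
  have sA4 := supp8M sA2 sA2.
  have sB4 := supp8M sB2 sB2.
  (* [H] collects the cross terms: 64 * 4 (A^3 B + A B^3) from S^4, and 128 times the even part 2 (2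
     A^3 B + 3 A^2 B^2 + 2 A B^3) of S^4, times S, from S^5. *)
  apply: (eqmod0_of_coef (m := 256) (H := 455 * (A ^+ 3 * B + A * B ^+ 3)
      - 1547 * (A + B) * (2 * A ^+ 3 * B + 3 * A ^+ 2 * B ^+ 2
         + 2 * A * B ^+ 3)
      + (4641 * (A + B) ^+ 6 - 6 * 4199 * (A + B) ^+ 7)) _ piE _
    (supp8D (supp8D (supp8D s4 (supp8Z 364 sS2))
        (supp8N (supp8Z 3640 (supp8M sS2 sS))))
      (supp8D
        (supp8Z 64 (supp8Z 455 (supp8D (supp8D sA4 sB4)
           (supp8Z 6 (supp8M sA2 sB2)))))
        (supp8N (supp8Z 128 (supp8Z 1547 (supp8M sS (supp8D sA4 sB4)))))))) => //.
    by ring.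
  by rewrite i8.
Qed.

Close Scope ring_scope.
Close Scope classical_set_scope.

Theorem theorem1p4 (R : realType) (p : nat -> nat)
    (hp : colored_overpartition_numbers R 13 p) (n : nat) :
  p (8 * n + 1)%N = 0%N %[mod 2] /\
  p (8 * n + 2)%N = 0%N %[mod 4] /\
  p (8 * n + 3)%N = 0%N %[mod 8] /\
  p (8 * n + 4)%N = 0%N %[mod 2] /\
  p (8 * n + 5)%N = 0%N %[mod 8] /\
  p (8 * n + 6)%N = 0%N %[mod 8] /\
  p (8 * n + 7)%N = 0%N %[mod 256].
Proof.
have H r := overpartition13_congruences (8 * n + r) hp.
have mod8 r : ((8 * n + r) %% 8 = r %% 8)%N by rewrite mulnC modnMDl.
by split; [|split; [|split; [|split; [|split; [|split]]]]];
  [have [+ _ _ _] := H 1|have [_ + _ _] := H 2|have [_ _ + _] := H 3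
  |have [+ _ _ _] := H 4|have [_ _ + _] := H 5|have [_ _ + _] := H 6
  |have [_ _ _ +] := H 7]; rewrite mod8; apply.
Qed.
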